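(* There exists a consistent atomic RCC8 network over $\{\mathbf{PO},\mathbf{NTPP},\mathbf{NTPP}^{-1}\}$ which has no convex solution in $\mathbb{R}$.
   Context: A region in $\mathbb{R}^n$ ($n\geq 1$) is a nonempty regular closed subset $X$, i.e. $X=\mathrm{cl}(\mathrm{int}(X))$; write $i(X)$ for the interior. The eight RCC8 base relations between regions $a,b$ (jointly exhaustive and pairwise disjoint; $\subset$ denotes proper inclusion) are: $a\,\mathbf{EQ}\,b$: $a=b$; $a\,\mathbf{DC}\,b$: $a\cap b=\emptyset$; $a\,\mathbf{EC}\,b$: $a\cap b\neq\emptyset$ and $i(a)\cap i(b)=\emptyset$; $a\,\mathbf{PO}\,b$: $i(a)\cap i(b)\neq\emptyset$, $a\not\subseteq b$, $b\not\subseteq a$; $a\,\mathbf{TPP}\,b$: $a\subset b$ and $a\not\subset i(b)$; $a\,\mathbf{NTPP}\,b$: $a\subset i(b)$; and the converses $\mathbf{TPP}^{-1}$, $\mathbf{NTPP}^{-1}$ of the last two. Let $V$ be a finite set of variables. An RCC8 constraint is an expression $u\,R\,v$ with $u,v\in V$ and $R$ a nonempty set of base relations; an RCC8 network is a set of such constraints. It is atomic if for every pair of distinct variables $u,v$ it contains a constraint $u\,R\,v$ or $v\,R\,u$ with $R$ a singleton. It is a network over a set $\mathcal{R}$ of base relations if every constraint $u\,R\,v$ in it has $R\subseteq\mathcal{R}$. An $n$-dimensional solution (solution in $\mathbb{R}^n$) of a network is a map $\mathcal{S}$ from $V$ to regions of $\mathbb{R}^n$ such that for each constraint $u\,R\,v$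 the base relation holding between $\mathcal{S}(u)$ and $\mathcal{S}(v)$ belongs to $R$. A network is consistent if it has a solution in $\mathbb{R}^n$ for some $n\geq 1$ (the regions need not be convex or connected). A solution is convex if every $\mathcal{S}(v)$ is a convex set. *)

(* Defs.v *)
From HB Require Import structures.
From mathcomp Require Import all_boot all_order all_algebra.
From mathcomp Require Import all_classical all_reals all_analysis.

Set Implicit Arguments.
Unset Strict Implicit.
Unset Printing Implicit Defensive.

Import Order.TTheory GRing.Theory Num.Theory.
Import numFieldNormedType.Exports.

Local Open Scope classical_set_scope.
Local Open Scope ring_scope.

Definition region (T : topologicalType) (A : set T) : Prop :=
  A !=set0 /\ regclosed A.

Inductive rcc8 : Type := EQ | DC | EC | PO | TPP | NTPP | TPPi | NTPPi.

Section Rcc8Semantics.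
Context {T : topologicalType}.
Implicit Types a b : set T.

Definition tpp a b : Prop := a `<` b /\ ~ (a `<` b°).

(* The inclusion is proper: otherwise the whole space, being open, would be
   both EQ and NTPP to itself. *)
Definition ntpp a b : Prop := a `<` b°.

Definition rcc8_holds (r : rcc8) a b : Prop :=
  match r with
  | EQ => a = b
  | DC => a `&` b = set0
  | EC => a `&` b !=set0 /\ a° `&` b° = set0
  | PO => [/\ a° `&` b° !=set0, ~ (a `<=` b) & ~ (b `<=` a)]
  | TPP => tpp a b
  | NTPP => ntpp a b
  | TPPi => tpp b a
  | NTPPi => ntpp b a
  end.

End Rcc8Semantics.

Record rcc8_constraint (V : Type) : Type := Rcc8Constraint {
  lhs : V;
  rels : set rcc8;
  rhs : V;
  rels_nonempty : rels !=set0
}.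

Definition rcc8_network (V : finType) : Type := set (rcc8_constraint V).

Section Networks.
Context {V : finType}.
Implicit Types N : rcc8_network V.

Definition atomic N : Prop :=
  forall u v : V, u != v ->
    exists c, [/\ N c,
      (lhs c = u /\ rhs c = v) \/ (lhs c = v /\ rhs c = u) &
      exists r, rels c = [set r]].

Definition network_over (B : set rcc8) N : Prop :=
  forall c, N c -> rels c `<=` B.

Definition solution (R : realType) (n : nat) N (S : V -> set 'rV[R]_n) : Prop :=
  (forall v, region (S v)) /\
  (forall c, N c ->
     exists2 r, rels c r & rcc8_holds r (S (lhs c)) (S (rhs c))).

Definition convex_solution (R : realType) (n : nat) N
    (S : V -> set 'rV[R]_n) : Prop :=
  solution N S /\ forall v, convex_set (S v).

Definition consistent (R : realType) N : Prop :=
  exists2 n : nat, (1 <= n)%N & exists S : V -> set 'rV[R]_n, solution N S.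

End Networks.

(* Main.v *)
Require Import Defs.
From mathcomp Require Import all_boot all_order all_algebra.
From mathcomp Require Import all_classical all_reals all_analysis.
From mathcomp Require Import ring lra.

(**
The witness is the standard example of a poset of dimension 3: variables a_i and
b_i for i < 3, with a_i NTPP b_j when i <> j, and PO between any other two
variables.

On the line, choose for each i a point x_i of a_i outside b_i. One of the three
points, say x_i, lies between the two others; these belong to b_i, so x_i belongs
to b_i by convexity, a contradiction.

Disconnected regions do give a solution on the line: with points c_0, c_1, ... far
apart, let a_i consist of the closed 1-balls around c_i and c_3, and b_i of the
closed 2-balls around all c_k with k <> i.
*)

Import Order.TTheory GRing.Theory Num.Theory.
Import numFieldNormedType.Exports.

Local Open Scope classical_set_scope.

(** * The network of the standard example *)

Definition crown_var : finType := (bool * 'I_3)%type.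

(* [(false, i)] is a_i and [(true, i)] is b_i. *)
Definition crown_lt (u v : crown_var) : bool :=
  [&& ~~ u.1, v.1 & u.2 != v.2].

Definition crown_rel (u v : crown_var) : rcc8 :=
  if crown_lt u v then NTPP else if crown_lt v u then NTPPi else PO.

(** Both orientations of each pair are constrained, whence [NTPPi]. The diagonal is left out because
    [crown_rel u u] is [PO], which no set bears to itself. *)
Definition crown_network : rcc8_network crown_var :=
  [set c | lhs c != rhs c /\ rels c = [set crown_rel (lhs c) (rhs c)]].

Lemma crown_networkP (u v : crown_var) : u != v ->
  exists c, [/\ crown_network c, lhs c = u, rhs c = v &
    rels c = [set crown_rel u v]].
Proof.
move=> uv; have ne : [set crown_rel u v] !=set0 by exists (crown_rel u v).
by exists (Rcc8Constraint u v ne).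
Qed.

(** * Convexity on the line *)

Section Convex.
Local Open Scope ring_scope.

Lemma convex_set_rV1 {R : realType} {A : set 'rV[R]_1} {x y z : 'rV[R]_1} :
  convex_set A -> A x -> A z -> x 0 0 <= y 0 0 -> y 0 0 <= z 0 0 -> A y.
Proof.
move=> cA Ax Az xy yz.
have [xz|xz] := eqVneq (x 0 0) (z 0 0).
  suff -> : y = x by [].
  by apply/rowP => i; rewrite ord1; apply/le_anti; rewrite xy xz yz.
have d_gt0 : 0 < z 0 0 - x 0 0 by rewrite subr_gt0 lt_neqAle xz (le_trans xy).
(* The weight of [x] in the convex combination of [x] and [z] equal to [y]. *)
pose t := (z 0 0 - y 0 0) / (z 0 0 - x 0 0).
have t0 : 0 <= t by rewrite divr_ge0 ?subr_ge0 // ltW // -subr_gt0.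
have t1 : t <= 1 by rewrite ler_pdivrMr // mul1r lerD2l lerN2.
have := cA x z (Itv01 t0 t1).
rewrite !inE => /(_ Ax Az); congr (A _).
apply/rowP => i; rewrite ord1 /conv /= !mxE /=.
rewrite /unstable.onem /t; field.
by rewrite gt_eqF.
Qed.

Lemma ord3_between {R : realType} (f : 'I_3 -> R) :
  exists i j k : 'I_3, [/\ j != i, k != i, f j <= f i & f i <= f k].
Proof.
pose a : 'I_3 := inord 0; pose b : 'I_3 := inord 1; pose c : 'I_3 := inord 2.
have [ab ac bc] : [/\ a != b, a != c & b != c].
  by split; rewrite -val_eqE /= !inordK.
have [ba ca cb] : [/\ b != a, c != a & c != b] by split; rewrite eq_sym.
(* Two of the eight outcomes are cyclic; there too, two consecutive inequalities exhibit a middle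
   index. *)
have [h1|/ltW h1] := leP (f a) (f b); have [h2|/ltW h2] := leP (f b) (f c);
  have [h3|/ltW h3] := leP (f a) (f c);
  solve [by exists b, a, c | by exists b, c, a | by exists a, b, c
       | by exists a, c, b | by exists c, a, b | by exists c, b, a].
Qed.

Lemma crown_no_convex_solution {R : realType} (S : crown_var -> set 'rV[R]_1) :
  ~ convex_solution crown_network S.
Proof.
move=> [[_ solS] cS].
have rS u v : u != v -> rcc8_holds (crown_rel u v) (S u) (S v).
  by move=> /crown_networkP[c [/solS[r cr Sr] <- <- cE]]; move: cr Sr; rewrite cE => ->.
have out i : exists x, S (false, i) x /\ ~ S (true, i) x.
  have := rS (false, i) (true, i) isT.
  by rewrite /crown_rel /crown_lt /= eqxx /= => -[_ /existsNP[x /not_implyP ?] _]; exists x.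
have [x xP] := choice out.
have [i [j [k [ji ki xji xik]]]] := ord3_between (fun i => x i 0 0).
have inb l : l != i -> S (true, i) (x l).
  move=> li; have := rS (false, l) (true, i) isT.
  rewrite /crown_rel /crown_lt /= li /= => -[/(_ (x l) (xP l).1) + _].
  exact: interior_subset.
exact: (xP i).2 (convex_set_rV1 (cS _) (inb _ ji) (inb _ ki) xji xik).
Qed.

End Convex.

(** * Regions built from balls around separated centres *)

Section Halo.
Local Open Scope ring_scope.

(** As the closure of an open set it is regular closed even for infinite [P]. *)
Definition halo {R : realType} {V : normedModType R} (c : nat -> V) (r : R)
  (P : set nat) : set V := closure (\bigcup_(k in P) ball (c k) r).

(** The 4 is the largest radius used, 3, plus the margin 1 of [halo_sub]. *)
Definition separated {R : realType} {V : normedModType R} (c : nat -> V) : Prop :=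
  forall j k, ball (c j) 4 (c k) -> j = k.

Context {R : realType} {V : normedModType R}.
Implicit Types (c : nat -> V) (r s : R) (P Q : set nat).

Lemma sub_halo_interior c r P :
  \bigcup_(k in P) ball (c k) r `<=` (halo c r P)°.
Proof.
rewrite -open_subsetE; first exact: subset_closure.
by apply: bigcup_open => k _; exact: ball_open.
Qed.

Lemma halo_interior_center {c r P k} : 0 < r -> P k -> (halo c r P)° (c k).
Proof.
by move=> r0 Pk; apply: sub_halo_interior; exists k => //; exact: ballxx.
Qed.

(** A point of the closure is within 1 of some ball, and this margin does not depend on the centre,
    so [P] may be infinite. *)
Lemma halo_sub {c r s P} : r + 1 <= s ->
  halo c r P `<=` \bigcup_(k in P) ball (c k) s.
Proof.
move=> rs x /(_ (ball x 1) (nbhsx_ballx _ _ ltr01)) [y [[k Pk cky] xy]].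
exists k => //; apply: (le_ball rs).
by apply: ball_triangle cky _; exact: ball_sym.
Qed.

Lemma halo_center {c r P k} : separated c -> r <= 3 -> halo c r P (c k) -> P k.
Proof.
move=> sep r3; have r4 : r + 1 <= 4 by lra.
by move=> /(halo_sub r4)[j Pj /sep <-].
Qed.

Lemma halo_region c r P : 0 < r -> P !=set0 -> region (halo c r P).
Proof.
move=> r0 [k Pk]; split.
  by exists (c k); apply: interior_subset; exact: halo_interior_center.
apply: closure_open_regclosed.
by apply: bigcup_open => j _; exact: ball_open.
Qed.

(** A centre with index in [P] but not in [Q] is the witness. The interior on the left is what the
    properness in [ntpp] calls for. *)
Lemma halo_not_sub {c r s P Q} : separated c -> 0 < r -> s <= 3 ->
  ~ P `<=` Q -> ~ (halo c r P)° `<=` halo c s Q.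
Proof.
move=> sep r0 s3 /existsNP[k /not_implyP[Pk nQk]] sub; apply: nQk.
by apply/(halo_center sep s3)/sub; exact: halo_interior_center.
Qed.

Lemma halo_PO {c r s P Q} : separated c -> 0 < r <= 3 -> 0 < s <= 3 ->
  P `&` Q !=set0 -> ~ P `<=` Q -> ~ Q `<=` P ->
  rcc8_holds PO (halo c r P) (halo c s Q).
Proof.
move=> sep /andP[r0 r3] /andP[s0 s3] [k [Pk Qk]] PQ QP; split.
- by exists (c k); split; exact: halo_interior_center.
- move/(subset_trans (@interior_subset _ _)); exact: halo_not_sub.
- move/(subset_trans (@interior_subset _ _)); exact: halo_not_sub.
Qed.

Lemma halo_NTPP {c r s P Q} : separated c -> 0 < r -> r + 1 <= s <= 3 ->
  P `<` Q -> rcc8_holds NTPP (halo c r P) (halo c s Q).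
Proof.
move=> sep r0 /andP[rs s3] [PQ QP]; split; last by apply: halo_not_sub => //; lra.
move=> x /(halo_sub rs)[k /PQ Qk ckx].
by apply: sub_halo_interior; exists k.
Qed.

End Halo.

(** * The disconnected solution on the line *)

Section Solution.
Local Open Scope ring_scope.

(** Index 3 is common to all variables, so that any two regions overlap. *)
Definition crown_centers (v : crown_var) : set nat :=
  if v.1 then [set k | k != v.2 :> nat] else [set k | (k == v.2 :> nat) || (k == 3)]%N.

(** The radii differ by the margin 1 that [halo_NTPP] requires. *)
Definition crown_radius {R : realType} (v : crown_var) : R :=
  if v.1 then 2 else 1.

Definition grid {R : realType} (k : nat) : 'rV[R]_1 := const_mx (4 * k%:R).

(** Balls are open, so spacing exactly 4 suffices. *)
Lemma grid_separated {R : realType} : separated (@grid R).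
Proof.
move=> j k [_ /(_ 0 0)]; rewrite !mxE -ball_normE /= ltr_norml => /andP[jk kj].
by case: (ltngtP j k) => //; rewrite -(ler_nat R) -natr1 => ?; exfalso; lra.
Qed.

Lemma crown_centers3 v : crown_centers v 3%N.
Proof. by case: v => [[] i]; rewrite /crown_centers /= ?orbT // gtn_eqF ?ltn_ord. Qed.

Lemma crown_centers_sub u v : crown_lt u v -> crown_centers u `<=` crown_centers v.
Proof.
move: u v => [[] i] [[] j] //= ij k /orP[] /eqP ->; first exact: ij.
exact: crown_centers3.
Qed.

Lemma crown_centers_not_sub u v : u != v -> ~~ crown_lt u v ->
  ~ crown_centers u `<=` crown_centers v.
Proof.
move: u v => [[] i] [[] j]; rewrite /crown_lt /crown_centers /= => uv.
- move=> _ /(_ j); rewrite /= eqxx => /(_ _)/negP; apply => //.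
  by apply: contraNneq uv => /ord_inj ->.
(* Index 4 belongs to every b_i and to no a_j. *)
- by move=> _ /(_ 4%N) /=; rewrite orbF !gtn_eqF ?(ltn_trans (ltn_ord _)) // => /(_ isT).
- by rewrite negbK => /eqP -> /(_ j) /=; rewrite eqxx => /(_ isT).
- move=> _ /(_ i) /=; rewrite eqxx (ltn_eqF (ltn_ord i)) !orbF => /(_ isT) /eqP/ord_inj ij.
  by rewrite ij eqxx in uv.
Qed.

Lemma crown_solution {R : realType} :
  solution crown_network
    (fun v => halo (@grid R) (crown_radius v) (crown_centers v)).
Proof.
have rad v : 0 < (crown_radius v : R) <= 3 by rewrite /crown_radius; case: v.1; lra.
have NTPP_lt u v : crown_lt u v -> rcc8_holds NTPP
    (halo (@grid R) (crown_radius u) (crown_centers u))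
    (halo (@grid R) (crown_radius v) (crown_centers v)).
  move=> uv; apply: halo_NTPP; first exact: grid_separated.
  - by case/andP: (rad u).
  - by move: uv; rewrite /crown_lt /crown_radius; case: u.1; case: v.1 => //= _; lra.
  - split; first exact: crown_centers_sub.
    (* The reverse inclusion fails because [crown_lt] is irreflexive and asymmetric. *)
    apply: crown_centers_not_sub; move: uv.
      by apply: contraTneq => ->; rewrite /crown_lt eqxx !andbF.
    by rewrite /crown_lt; case: u.1; case: v.1.
split=> [v|c [uv cE]].
  apply: halo_region; first by case/andP: (rad v).
  by exists 3%N; exact: crown_centers3.
exists (crown_rel (lhs c) (rhs c)); first by rewrite cE.
rewrite /crown_rel; case: ifPn => [|nuv]; first exact: NTPP_lt.
case: ifPn => [|nvu]; first exact: NTPP_lt.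
apply: halo_PO (rad _) (rad _) _ _ _; first exact: grid_separated.
- by exists 3%N; split; exact: crown_centers3.
- exact: crown_centers_not_sub.
- by apply: crown_centers_not_sub => //; rewrite eq_sym.
Qed.

End Solution.

Theorem corollary4 (R : realType) :
  exists (V : finType) (N : rcc8_network V),
    [/\ atomic N,
        network_over [set PO; NTPP; NTPPi] N,
        consistent R N &
        ~ (exists S : V -> set 'rV[R]_1, convex_solution N S)].
Proof.
exists crown_var, crown_network; split.
- move=> u v /crown_networkP[c [Nc cu cv cE]].
  by exists c; split => //; [left|exists (crown_rel u v)].
- move=> c [_ ->] _ ->; rewrite /crown_rel.
  by case: ifP => _; [left; right|case: ifP => _; [right|left; left]].
- by exists 1 => //; exists (fun v => halo (@grid R) (crown_radius v) (crown_centers v));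
    exact: crown_solution.
- by move=> [S]; exact: crown_no_convex_solution.
Qed.
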